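(* Let $\alpha\in(0,1]$, let $n\ge1$ be an integer, let $p_0,\dots,p_{n-1}$ be real constants, let $q$ be a function on $(0,\infty)$, and consider the equation $${}^nT_\alpha y+p_{n-1}\,{}^{n-1}T_\alpha y+\cdots+p_2\,{}^2T_\alpha y+p_1T_\alpha y+p_0y=q(t)\qquad (t>0).$$ Let $u(t)=\sum_{i=1}^n c_iy_i(t)$, with $c_1,\dots,c_n$ arbitrary constants, be a solution of the corresponding homogeneous equation (the equation with $q=0$); in particular each $y_i$ is a solution of the homogeneous equation. Let $c_1(t),\dots,c_n(t)$ be $\alpha$-differentiable functions on $(0,\infty)$ satisfying, for all $t>0$, the system $$\sum_{i=1}^n c_i^{(\alpha)}(t)\,{}^jT_\alpha y_i(t)=0\quad (j=0,1,\dots,n-2),\qquad \sum_{i=1}^n c_i^{(\alpha)}(t)\,{}^{n-1}T_\alpha y_i(t)=q(t).$$ Then $v(t)=\sum_{i=1}^n c_i(t)y_i(t)$ is a particular solution of the non-homogeneous equation.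
   Context: For $\alpha\in(0,1]$ and a function $f$ on $(0,\infty)$, the conformable fractional derivative of order $\alpha$ at $t>0$ is $T_\alpha f(t)=f^{(\alpha)}(t)=\lim_{\varepsilon\to0}\frac{f(t+\varepsilon t^{1-\alpha})-f(t)}{\varepsilon}$, when the limit exists ($f$ is then called $\alpha$-differentiable at $t$). ${}^jT_\alpha=T_\alpha T_\alpha\cdots T_\alpha$ ($j$ times), with ${}^0T_\alpha f=f$. A solution is an $n$ times $\alpha$-differentiable function on $(0,\infty)$ satisfying the equation for all $t>0$. *)

(* Defs.v *)
From HB Require Import structures.
From mathcomp Require Import all_boot all_order all_algebra.
From mathcomp Require Import all_classical all_reals all_analysis.

Set Implicit Arguments.
Unset Strict Implicit.
Unset Printing Implicit Defensive.

Import Order.TTheory GRing.Theory Num.Theory.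
Import numFieldNormedType.Exports.

Local Open Scope classical_set_scope.
Local Open Scope ring_scope.

(* A function on (0, +oo) is encoded as a total function R -> R of which only
   the values at positive arguments matter: for t > 0 the point
   t + e * t `^ (1 - alpha) is positive for all small e, so the limits below
   depend only on the restriction of f to (0, +oo). *)

Definition conf_quotient (R : realType) (alpha : R) (f : R -> R) (t e : R) : R :=
  (f (t + e * t `^ (1 - alpha)) - f t) / e.

Definition conf_derivable (R : realType) (alpha : R) (f : R -> R) (t : R) : Prop :=
  cvg (conf_quotient alpha f t e @[e --> 0^']).

(* Meaningful only where [conf_derivable alpha f t] holds. *)
Definition conf_derive (R : realType) (alpha : R) (f : R -> R) : R -> R :=
  fun t => lim (conf_quotient alpha f t e @[e --> 0^']).

Definition conf_deriven (R : realType) (alpha : R) (j : nat) (f : R -> R) : R -> R :=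
  iter j (conf_derive alpha) f.

Definition conf_derivable_upto (R : realType) (alpha : R) (n : nat)
    (f : R -> R) : Prop :=
  forall j : nat, (j < n)%N ->
  forall t : R, 0 < t -> conf_derivable alpha (conf_deriven alpha j f) t.

Definition conf_solution (R : realType) (alpha : R) (n : nat)
    (p : 'I_n -> R) (q : R -> R) (y : R -> R) : Prop :=
  conf_derivable_upto alpha n y /\
  forall t : R, 0 < t ->
    conf_deriven alpha n y t + \sum_(j < n) p j * conf_deriven alpha j y t = q t.

(* Main.v *)
Require Import Defs.
From HB Require Import structures.
From mathcomp Require Import all_boot all_order all_algebra.
From mathcomp Require Import all_classical all_reals all_analysis.

Set Implicit Arguments.
Unset Strict Implicit.
Unset Printing Implicit Defensive.

Import Order.TTheory GRing.Theory Num.Theory.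
Import numFieldNormedType.Exports.

Local Open Scope classical_set_scope.
Local Open Scope ring_scope.

(** Variation of parameters works for the conformable derivative because this
    derivative obeys the same sum and product rules as the ordinary one.  By
    the product rule ([is_conf_derive_sumM]), whenever the [j]-th derivative of
    [v = \sum_i c_i y_i] equals [\sum_i c_i D^j y_i] on the positive half-line,
    the next one exists and equals
    [\sum_i c_i' D^j y_i + \sum_i c_i D^(j+1) y_i] ([variation_step]).  The
    first sum vanishes for [j < n - 1], so inductively [D^j v] is
    [\sum_i c_i D^j y_i] for all [j < n] ([variation_deriven]); for
    [j = n - 1] that first sum is [q], so
    [D^n v = q + \sum_i c_i D^n y_i].  Substituting into the equation, the
    coefficient of each [c_i] is the left-hand side of the homogeneous equation
    at [y_i], which is zero. *)

(** [l] is the conformable derivative of [f] at [t]: existence and value of the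
    limit in a single relation. *)
Definition is_conf_derive (R : realType) (alpha : R) (f : R -> R) (t l : R) :
  Prop := conf_quotient alpha f t e @[e --> 0^'] --> l.

Lemma conf_derivableP (R : realType) (alpha : R) (f : R -> R) (t : R) :
  conf_derivable alpha f t <-> is_conf_derive alpha f t (conf_derive alpha f t).
Proof. by split=> [//|] fl; apply: (cvgP _ fl). Qed.

Lemma is_conf_derive_derivable (R : realType) (alpha : R) (f : R -> R)
    (t l : R) :
  is_conf_derive alpha f t l -> conf_derivable alpha f t.
Proof. exact: cvgP. Qed.

Lemma is_conf_derive_derive (R : realType) (alpha : R) (f : R -> R) (t l : R) :
  is_conf_derive alpha f t l -> conf_derive alpha f t = l.
Proof. by move=> fl; apply: cvg_lim. Qed.

Lemma cvg_conf_shift (R : realType) (t a : R) :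
  t + e * a @[e --> (0 : R)^'] --> t.
Proof.
rewrite -[X in _ --> X]addr0 -[X in _ --> _ + X](mul0r a).
apply: cvgD; first exact: cvg_cst.
by apply: cvgMr_tmp; apply: nbhs_dnbhs.
Qed.

(** At a positive point only the values on the positive half-line matter. *)
Lemma is_conf_derive_ext (R : realType) (alpha : R) (f g : R -> R) (t l : R) :
  0 < t -> (forall s : R, 0 < s -> f s = g s) ->
  is_conf_derive alpha f t l -> is_conf_derive alpha g t l.
Proof.
move=> t0 fg; rewrite /is_conf_derive; apply: cvg_trans.
apply: near_eq_cvg; near=> e.
rewrite /conf_quotient !fg //.
near: e.
have := @cvg_conf_shift _ t (t `^ (1 - alpha)).
by move/cvgr_gt; apply.
Unshelve. all: by end_near. Qed.

(** Conformable differentiability implies continuity along the shifts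
    [e |-> t + e * t `^ (1 - alpha)] of the quotient, which is all that the
    product rule needs. *)
Lemma is_conf_derive_cvg (R : realType) (alpha : R) (f : R -> R) (t l : R) :
  is_conf_derive alpha f t l ->
  f (t + e * t `^ (1 - alpha)) @[e --> 0^'] --> f t.
Proof.
move=> fl.
have : f t + e * conf_quotient alpha f t e @[e --> 0^'] --> f t + 0 * l.
  apply: cvgD; first exact: cvg_cst.
  by apply: cvgM => //; apply: nbhs_dnbhs.
rewrite mul0r addr0; apply: cvg_trans; apply: near_eq_cvg.
near=> e.
have e0 : e != 0 by near: e; exact: nbhs_dnbhs_neq.
by rewrite /conf_quotient mulrC divfK // addrC subrK.
Unshelve. all: by end_near. Qed.

Lemma is_conf_deriveM (R : realType) (alpha : R) (f g : R -> R) (t l m : R) :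
  is_conf_derive alpha f t l -> is_conf_derive alpha g t m ->
  is_conf_derive alpha (fun s => f s * g s) t (l * g t + f t * m).
Proof.
move=> fl gm; have gc := is_conf_derive_cvg gm.
have : conf_quotient alpha f t e * g (t + e * t `^ (1 - alpha)) +
    f t * conf_quotient alpha g t e @[e --> 0^'] --> l * g t + f t * m.
  apply: cvgD; first exact: cvgM.
  by apply: cvgM => //; apply: cvg_cst.
rewrite /is_conf_derive; apply: cvg_trans; apply: near_eq_cvg; near=> e => /=.
rewrite /conf_quotient mulrAC mulrA -mulrDl; congr (_ / _).
by rewrite mulrBl mulrBr addrA subrK.
Unshelve. all: by end_near. Qed.

Lemma is_conf_derive_sumM (R : realType) (alpha : R) (n : nat)
    (c y : 'I_n -> R -> R) (c' y' : 'I_n -> R) (t : R) :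
  (forall i, is_conf_derive alpha (c i) t (c' i)) ->
  (forall i, is_conf_derive alpha (y i) t (y' i)) ->
  is_conf_derive alpha (fun s => \sum_(i < n) c i s * y i s) t
    (\sum_(i < n) c' i * y i t + \sum_(i < n) c i t * y' i).
Proof.
move=> cd yd; rewrite -big_split /=.
have : \sum_(i < n) conf_quotient alpha (fun s => c i s * y i s) t e @[e --> 0^']
    --> \sum_(i < n) (c' i * y i t + c i t * y' i).
  by apply: cvg_big => [|i _]; [exact: add_continuous|]; apply: is_conf_deriveM.
rewrite /is_conf_derive; apply: cvg_trans; apply: near_eq_cvg; near=> e => /=.
by rewrite /conf_quotient -sumrB mulr_suml.
Unshelve. all: by end_near. Qed.

Lemma conf_derivenS (R : realType) (alpha : R) (j : nat) (f : R -> R) :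
  conf_deriven alpha j.+1 f = conf_derive alpha (conf_deriven alpha j f).
Proof. by []. Qed.

(** Differentiating [D^j v = \sum_i c_i D^j y_i] once more, before any of the
    conditions on the [c_i'] are used. *)
Lemma variation_step (R : realType) (alpha : R) (n j : nat)
    (y c : 'I_n -> R -> R) (v : R -> R) (t : R) :
  0 < t -> (forall i, conf_derivable alpha (c i) t) ->
  (forall i, conf_derivable alpha (conf_deriven alpha j (y i)) t) ->
  (forall s : R, 0 < s ->
     conf_deriven alpha j v s = \sum_(i < n) c i s * conf_deriven alpha j (y i) s) ->
  is_conf_derive alpha (conf_deriven alpha j v) t
    (\sum_(i < n) conf_derive alpha (c i) t * conf_deriven alpha j (y i) t +
     \sum_(i < n) c i t * conf_deriven alpha j.+1 (y i) t).
Proof.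
move=> t0 cd yd vE.
apply: (is_conf_derive_ext t0 (fun s s0 => esym (vE s s0))).
by apply: is_conf_derive_sumM => i; [have := cd i|have := yd i] => /conf_derivableP.
Qed.

Lemma variation_deriven (R : realType) (alpha : R) (n : nat)
    (y c : 'I_n -> R -> R) :
  (forall i (t : R), 0 < t -> conf_derivable alpha (c i) t) ->
  (forall i, conf_derivable_upto alpha n (y i)) ->
  (forall t : R, 0 < t -> forall j, (j.+1 < n)%N ->
    \sum_(i < n) conf_derive alpha (c i) t * conf_deriven alpha j (y i) t = 0) ->
  forall j, (j < n)%N -> forall t : R, 0 < t ->
  conf_deriven alpha j (fun s => \sum_(i < n) c i s * y i s) t =
    \sum_(i < n) c i t * conf_deriven alpha j (y i) t.
Proof.
move=> cd yd sys; elim=> [//|j IH] jn t t0.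
have jn' := ltnW jn.
rewrite conf_derivenS.
have := variation_step t0 (fun i => cd i t t0) (fun i => yd i j jn' t t0) (IH jn').
by move/is_conf_derive_derive => ->; rewrite sys // add0r.
Qed.

Theorem theorem4p1 (R : realType) (alpha : R) (n : nat)
    (p : 'I_n -> R) (q : R -> R) (y c : 'I_n -> R -> R)
    (alpha_gt0 : 0 < alpha) (alpha_le1 : alpha <= 1) (n_ge1 : (1 <= n)%N)
    (hom_sol : forall k : 'I_n -> R,
      conf_solution alpha p (fun _ : R => 0) (fun t : R => \sum_(i < n) k i * y i t))
    (c_der : forall (i : 'I_n) (t : R), 0 < t -> conf_derivable alpha (c i) t)
    (sys_low : forall t : R, 0 < t -> forall j : nat, (j.+1 < n)%N ->
      \sum_(i < n) conf_derive alpha (c i) t * conf_deriven alpha j (y i) t = 0)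
    (sys_top : forall t : R, 0 < t ->
      \sum_(i < n) conf_derive alpha (c i) t * conf_deriven alpha n.-1 (y i) t = q t) :
  conf_solution alpha p q (fun t : R => \sum_(i < n) c i t * y i t).
Proof.
(* The hypothesis on all linear combinations, at a basis vector, gives [y i]. *)
have ysol i : conf_solution alpha p (fun=> 0) (y i).
  have := hom_sol (fun k => (k == i)%:R); congr conf_solution.
  apply/funext => t; rewrite (bigD1 i) //= eqxx mul1r big1 ?addr0 // => k.
  by move=> /negbTE ->; rewrite mul0r.
have yd i := (ysol i).1.
have vE := variation_deriven c_der yd sys_low.
have step j (jn : (j < n)%N) t (t0 : 0 < t) :=
  variation_step t0 (fun i => c_der i t t0) (fun i => yd i j jn t t0) (vE j jn).
split=> [j jn t t0|t t0]; first exact: is_conf_derive_derivable (step j jn t t0).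
(* The top condition of the system enters in the last differentiation. *)
have n1 : (n.-1 < n)%N by rewrite prednK.
have := is_conf_derive_derive (step _ n1 t t0).
rewrite -conf_derivenS prednK // sys_top // => ->.
have -> : \sum_(j < n) p j * conf_deriven alpha j
    (fun s => \sum_(i < n) c i s * y i s) t =
    \sum_(j < n) \sum_(i < n) p j * (c i t * conf_deriven alpha j (y i) t).
  by apply: eq_bigr => j _; rewrite vE // mulr_sumr.
rewrite exchange_big -addrA -big_split /= big1 ?addr0 // => i _.
transitivity (c i t * (conf_deriven alpha n (y i) t +
    \sum_(j < n) p j * conf_deriven alpha j (y i) t)).
  rewrite mulrDr mulr_sumr; congr (_ + _).
  by apply: eq_bigr => j _; rewrite mulrCA.
by rewrite (ysol i).2 // mulr0.
Qed.
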